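(* Let $1\le p<\infty$, $1/p+1/q=1$, and let $X$ be a closed subspace of $L_p(\mathbb{R})$. Suppose either (i) $(f_i,g_i)_{i=1}^\infty\subseteq L_p(\mathbb{R})\times L_q(\mathbb{R})$ is a frame for $X$ satisfying condition $( * )$: for all $\varepsilon>0$ and all bounded intervals $I\subseteq\mathbb{R}$ there exists $n\in\mathbb{N}$ such that for all $m\ge n$ and all $f\in X$, $\big\|\sum_{i=m+1}^\infty\langle f,g_i\rangle f_i|_I\big\|_p\le\varepsilon\|f\|_p$; or (ii) $(f_i)_{i=1}^\infty$ is a semi-normalized bounded fundamental minimal system for $X$ satisfying condition $( ** )$: for all $\varepsilon>0$ and all bounded intervals $I\subseteq\mathbb{R}$ there exists $n\in\mathbb{N}$ such that for all $n<m\le m_1\le m_2$ and all $f=\sum_{i=1}^{m_2}a_if_i$ with $\|f\|_p=1$, one has $\big\|\sum_{i=m}^{m_1}a_if_i|_I\big\|_p\le\varepsilon$. Then $X$ embeds almost isometrically into $\ell_p$.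
   Context: A frame for $X$ is a sequence $(f_i,g_i)\subseteq X\times L_q(\mathbb{R})$ with $f=\sum_{i=1}^\infty\langle f,g_i\rangle f_i$ in norm for all $f\in X$, where $\langle f,g\rangle=\int fg$. A sequence $(f_i)$ is semi-normalized if $0<\inf\|f_i\|\le\sup\|f_i\|<\infty$; it is a bounded minimal system if there exist functionals $(f_i^* )\subseteq X^*$ with $f_i^*(f_j)=\delta_{ij}$ and $\sup_i\|f_i\|\|f_i^*\|<\infty$; fundamental means its closed linear span is $X$. $g|_I$ denotes restriction of $g$ to $I$. $X$ embeds almost isometrically into $\ell_p$ if for every $\varepsilon>0$ there is a linear $T:X\to\ell_p$ with $(1+\varepsilon)^{-1}\le\|Tf\|\le1+\varepsilon$ for all $f\in X$ with $\|f\|=1$. *)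

(* Defs.v *)
From HB Require Import structures.
From mathcomp Require Import all_boot all_order all_algebra.
From mathcomp Require Import all_classical all_reals all_analysis.
Set Implicit Arguments. Unset Strict Implicit. Unset Printing Implicit Defensive.
Import Order.TTheory GRing.Theory Num.Def Num.Theory.
Import numFieldNormedType.Exports.
Local Open Scope classical_set_scope.
Local Open Scope ring_scope.

Section Defs.
Context {R : realType}.
Implicit Types (p q : \bar R) (f g h : R -> R).

Definition inL p f : Prop :=
  measurable_fun [set: R] f /\ finite_norm (@lebesgue_measure R) p f.

Definition Lpnorm p f : R := fine ('N[@lebesgue_measure R]_p [EFin \o f])%E.

Definition pairing f g : R :=
  fine (\int[@lebesgue_measure R]_x (f x * g x)%:E)%E.

Definition bitv (b1 : bool) (a : R) (b2 : bool) (b : R) : set R :=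
  [set` Interval (BSide b1 a) (BSide b2 b)].

Definition restr (I : set R) g : R -> R := fun x => if x \in I then g x else 0.

Definition closed_subspace (p : R) (X : set (R -> R)) : Prop :=
  [/\ (forall f, X f -> inL p%:E f),
      X (fun _ => 0),
      (forall f g (c : R), X f -> X g -> X (fun x => f x + c * g x)) &
      (forall (u : nat -> R -> R) f, (forall n, X (u n)) -> inL p%:E f ->
         (fun n => Lpnorm p%:E (fun x => f x - u n x)) @ \oo --> 0 -> X f)].

Definition is_frame (p : R) (X : set (R -> R)) (f g : nat -> R -> R) : Prop :=
  [/\ (forall i, X (f i)),
      (forall i, inL (hoelder_conjugate p%:E) (g i)) &
      (forall h, X h ->
         (fun n => Lpnorm p%:E
            (fun x => h x - \sum_(i < n) pairing h (g i) * f i x)) @ \oo --> 0)].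

(** Condition ( * ) (0-based: the tail sum_{i=m+1}^oo becomes h - sum_{i<m}). *)
Definition cond_star (p : R) (X : set (R -> R)) (f g : nat -> R -> R) : Prop :=
  forall eps : R, 0 < eps -> forall b1 a b2 b,
  exists n : nat, forall m : nat, (n <= m)%N -> forall h, X h ->
    Lpnorm p%:E (restr (bitv b1 a b2 b)
                   (fun x => h x - \sum_(i < m) pairing h (g i) * f i x))
    <= eps * Lpnorm p%:E h.

Definition dual_elt (p : R) (X : set (R -> R)) (phi : (R -> R) -> R) : Prop :=
  [/\ (forall f g, X f -> X g -> phi (fun x => f x + g x) = phi f + phi g),
      (forall f (c : R), X f -> phi (fun x => c * f x) = c * phi f) &
      (exists K : R, forall f, X f -> `|phi f| <= K * Lpnorm p%:E f)].

Definition sn_bdd_fund_minimal (p : R) (X : set (R -> R)) (f : nat -> R -> R) :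
    Prop :=
  [/\ (forall i, X (f i)),
      (exists c C : R, 0 < c /\ forall i, c <= Lpnorm p%:E (f i) <= C),
      (exists fs : nat -> (R -> R) -> R,
         [/\ (forall i, dual_elt p X (fs i)),
             (forall i j, fs i (f j) = if i == j then 1 else 0) &
             (exists M : R, forall i h, X h ->
                Lpnorm p%:E (f i) * `|fs i h| <= M * Lpnorm p%:E h)]) &
      (forall h, X h -> forall eps : R, 0 < eps ->
         exists (n : nat) (a : nat -> R),
           Lpnorm p%:E (fun x => h x - \sum_(i < n) a i * f i x) <= eps)].

(** Condition ( ** ) (0-based indices: paper's f_i is f (i-1)). *)
Definition cond_2star (p : R) (f : nat -> R -> R) : Prop :=
  forall eps : R, 0 < eps -> forall b1 a b2 b,
  exists n : nat, forall m m1 m2 : nat, (n < m)%N -> (m <= m1)%N -> (m1 <= m2)%N ->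
    forall c : nat -> R,
      Lpnorm p%:E (fun x => \sum_(i < m2) c i * f i x) = 1 ->
      Lpnorm p%:E (restr (bitv b1 a b2 b)
                     (fun x => \sum_(m.-1 <= i < m1) c i * f i x)) <= eps.

Definition lpnorm (p : R) (a : nat -> R) : \bar R :=
  ('N[@counting nat R]_p%:E [EFin \o a])%E.

Definition almost_isometric_lp (p : R) (X : set (R -> R)) : Prop :=
  forall eps : R, 0 < eps ->
  exists T : (R -> R) -> nat -> R,
    [/\ (* T is well defined on L_p classes *)
        (forall f g, X f -> X g -> Lpnorm p%:E (fun x => f x - g x) = 0 -> T f = T g),
        (forall f g, X f -> X g -> T (fun x => f x + g x) = (fun i => T f i + T g i)),
        (forall f (c : R), X f -> T (fun x => c * f x) = (fun i => c * T f i)),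
        (forall f, X f -> (lpnorm p (T f) < +oo)%E) &
        (forall f, X f -> Lpnorm p%:E f = 1 ->
           (((1 + eps)^-1)%:E <= lpnorm p (T f) <= (1 + eps)%:E)%E)].

End Defs.

(* Main.v *)
(* Either condition makes the restriction of X to a bounded interval a limit of
   maps with range in a finite-dimensional space, with coefficients bounded on
   the unit sphere: f |-> sum_{i<n} <f,g_i> f_i in case (i), the first n terms
   of an expansion in case (ii).  Splitting R into annuli and quantizing the
   finitely many f_i involved on each of them gives a countable measurable
   partition such that every norm-one h in X is within delta of a function that
   is constant on each cell.  Averaging over the cells is a linear contraction
   from L_p to l_p that is isometric on such functions, so it distorts the norm
   on the unit sphere of X by at most 2 delta. *)
Require Import Defs.
From HB Require Import structures.
From mathcomp Require Import all_boot all_order all_algebra.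
From mathcomp Require Import all_classical all_reals all_analysis.
From mathcomp Require Import ess_sup_inf measurable_realfun ring lra.
Set Implicit Arguments. Unset Strict Implicit. Unset Printing Implicit Defensive.
Import Order.TTheory GRing.Theory Num.Def Num.Theory.
Import numFieldNormedType.Exports.
Local Open Scope classical_set_scope.
Local Open Scope ring_scope.

(** * Countable measurable partitions, encoded as labels in [nat] *)

Section Labels.
Context d (T : measurableType d) (R : realType).
Implicit Types l : T -> nat.

Lemma measurable_fun_label l :
  (forall j, measurable (l @^-1` [set j])) -> measurable_fun [set: T] l.
Proof.
move=> ml _ Y _; rewrite setTI.
rewrite (_ : l @^-1` Y = \bigcup_(j in Y) l @^-1` [set j]).
  by apply: bigcup_measurable => j _; exact: ml.
by rewrite -preimage_bigcup bigcup_imset1 image_id.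
Qed.

Lemma measurable_label_fiber l (j : nat) :
  measurable_fun [set: T] l -> measurable (l @^-1` [set j]).
Proof. by move=> ml; rewrite -[X in measurable X]setTI; exact: ml. Qed.

Lemma ge0_integral_fibers (mu : {measure set T -> \bar R}) l (F : T -> \bar R) :
  measurable_fun [set: T] l -> measurable_fun [set: T] (F : T -> \bar R) ->
  (forall x, 0 <= F x)%E ->
  (\int[mu]_x F x = \sum_(j <oo) \int[mu]_(x in l @^-1` [set j]) F x)%E.
Proof.
move=> ml mF F0.
have E : \bigcup_j l @^-1` [set j] = [set: T].
  by rewrite -preimage_bigcup bigcup_imset1 image_id.
rewrite -E ge0_integral_bigcup ?E//.
- by move=> j; exact: measurable_label_fiber.
- by apply/trivIsetP => i j _ _ ij; apply/seteqP; split => // x [/= xi xj];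
    move: ij; rewrite -xi -xj eqxx.
Qed.

Lemma measurable_floor_div (f : T -> R) (s : R) (z : int) : 0 < s ->
  measurable_fun [set: T] f -> measurable [set x | Num.floor (f x / s) = z].
Proof.
move=> s0 mf.
rewrite (_ : mkset _ = f @^-1` `[z%:~R * s, (z + 1)%:~R * s[%classic).
  by rewrite -[X in measurable X]setTI; exact: mf.
apply/seteqP; split => x /=; rewrite in_itv/= -ler_pdivlMr// -ltr_pdivrMr//.
  by move=> <-; exact: Num.Theory.floor_itv.
by move=> /floor_def.
Qed.

(** Each [f i] is rounded down to a multiple of a small step [s], and the label of a point codes the
    list of its [n] integer quotients. The label depends on [K] but not on [c], so one partition
    serves all coefficient vectors bounded by [K]. *)
Lemma quantize (n : nat) (f : nat -> T -> R) (K eta : R) :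
  (forall i, measurable_fun [set: T] (f i)) -> 0 < eta ->
  exists2 l : T -> nat, measurable_fun [set: T] l &
    forall c : nat -> R, (forall i, (i < n)%N -> `|c i| <= K) ->
    exists w : nat -> R, forall x, `|\sum_(i < n) c i * f i x - w (l x)| <= eta.
Proof.
move=> mf eta0.
(* The total rounding error is at most [n * |K| * s], hence at most [eta]. The absolute value and
   the [+ 1] keep the denominator positive for every [n] and [K]. *)
pose s := eta / (n%:R * `|K| + 1).
have D0 : 0 < n%:R * `|K| + 1 by rewrite ltr_wpDl// mulr_ge0.
have s0 : 0 < s by rewrite divr_gt0.
pose q i x : int := Num.floor (f i x / s).
pose t x := [seq q i x | i <- iota 0 n].
exists (fun x => pickle (t x)).
  apply: measurable_fun_label => j.
  (* A number [j] that codes no list of length [n] has an empty fiber. Otherwise the fiber is a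
     finite intersection of level sets of floors. *)
  have [[u [su <-]]|uj] := pselect (exists u : seq int, size u = n /\ pickle u = j);
      last first.
    rewrite (_ : _ @^-1` _ = set0); first exact: measurable0.
    apply/seteqP; split => // x /= xj; apply: uj; exists (t x); split => //.
    by rewrite size_map size_iota.
  rewrite (_ : _ @^-1` _ = \bigcap_(i < n) [set x | q i x = nth 0 u i]).
    by apply: fin_bigcap_measurable => // i _; exact: measurable_floor_div.
  apply/seteqP; split => x /=.
    move=> /(pcan_inj pickleK) <- i /= ni.
    by rewrite (nth_map 0%N) ?size_iota// nth_iota.
  move=> H; congr pickle; apply: (@eq_from_nth _ 0) => [|i].
    by rewrite size_map size_iota.
  rewrite size_map size_iota => ni.
  by rewrite (nth_map 0%N) ?size_iota// nth_iota//; exact: H.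
move=> c cK.
(* The cell value is the same linear combination taken at the rounded values decoded from the label.
   The default [[::]] is never reached on an actual label. *)
exists (fun j => \sum_(i < n) c i * ((nth 0 (odflt [::] (unpickle j)) i)%:~R * s)).
move=> x; rewrite pickleK/= -sumrB.
apply: (le_trans (ler_norm_sum _ _ _)).
apply: (@le_trans _ _ (\sum_(i < n) `|K| * s)).
  apply: ler_sum => i _; rewrite -mulrBr normrM ler_pM//.
    exact: (le_trans (cK _ (ltn_ord i)) (ler_norm _)).
  rewrite (nth_map 0%N) ?size_iota// nth_iota// add0n.
  have /andP[q1 q2] := Num.Theory.floor_itv (f i x / s).
  rewrite -/(q i x) in q1 q2.
  move: q1 q2; rewrite ler_pdivlMr// ltr_pdivrMr// intrD mulrDl mul1r => q1 q2.
  by rewrite ger0_norm ?subr_ge0// lerBlDl ltW.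
rewrite sumr_const card_ord -mulr_natl mulrA /s mulrCA ger_pMr//.
by rewrite ler_pdivrMr// mul1r lerDl.
Qed.

End Labels.

(** * From finite-dimensional approximation to functions constant on cells *)

Section Approximation.
Context d (T : measurableType d) (R : realType).
Variables (mu : {measure set T -> \bar R}) (p : R).
Hypothesis p1 : 1 <= p.

Let p0 : 0 < p. Proof. exact: lt_le_trans p1. Qed.

(** The constant comes from bounding the sum by twice the larger of the two absolute values. *)
Lemma powR_normD_le (a b : R) :
  `|a + b| `^ p <= 2 `^ p * (`|a| `^ p + `|b| `^ p).
Proof.
wlog ab : a b / `|a| <= `|b|.
  move=> H; have [/H//|/ltW/H] := leP `|a| `|b|.
  by rewrite addrC (addrC (_ `^ _)).
rewrite (@le_trans _ _ ((2 * `|b|) `^ p))//.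
  rewrite ge0_ler_powR ?nnegrE ?mulr_ge0 ?(ltW p0)//.
  by rewrite (le_trans (ler_normD _ _))// mulr_natl mulr2n lerD2r.
by rewrite powRM// ler_wpM2l ?powR_ge0// lerDr powR_ge0.
Qed.

Lemma measurable_norm_powR (f : T -> R) : measurable_fun [set: T] f ->
  measurable_fun [set: T] (fun x => (`|f x| `^ p)%:E).
Proof.
move=> mf; apply/measurable_EFinP.
by apply: (measurableT_comp (measurable_powR _)); exact: measurableT_comp.
Qed.

Lemma measurable_label_comp (h : T -> R) (w : nat -> R) (l : T -> nat) :
  measurable_fun [set: T] h -> measurable_fun [set: T] l ->
  measurable_fun [set: T] (fun x => h x - w (l x)).
Proof.
move=> mh ml; apply: measurable_funB => //.
exact: (@measurableT_comp _ _ _ _ _ _ w).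
Qed.

Lemma measurable_lincomb (n : nat) (c : nat -> R) (f : nat -> T -> R) :
  (forall i, measurable_fun [set: T] (f i)) ->
  measurable_fun [set: T] (fun x => \sum_(i < n) c i * f i x).
Proof.
by move=> mf; apply: measurable_sum => i; exact: measurable_funM.
Qed.

(* [c] need not depend linearly on [h]: linearity of the embedding comes from
   averaging, not from the approximants. *)
Definition finite_dim_approx (X : set (T -> R)) (J : set T) :=
  forall eta : R, 0 < eta -> exists (n : nat) (f : nat -> T -> R) (K : R),
    (forall i, measurable_fun [set: T] (f i)) /\
    forall h, X h -> exists2 c : nat -> R, (forall i, (i < n)%N -> `|c i| <= K) &
      (\int[mu]_(x in J) (`|h x - \sum_(i < n) c i * f i x| `^ p)%:E <= eta%:E)%E.

Lemma local_label (X : set (T -> R)) (J : set T) (eta : R) :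
  (forall h, X h -> measurable_fun [set: T] h) ->
  measurable J -> (mu J < +oo)%E -> finite_dim_approx X J -> 0 < eta ->
  exists2 l : T -> nat, measurable_fun [set: T] l &
    forall h, X h -> exists w : nat -> R,
      (\int[mu]_(x in J) (`|h x - w (l x)| `^ p)%:E <= eta%:E)%E.
Proof.
move=> mX mJ Joo XJ eta0.
have c0 : 0 < 2 `^ p :> R by rewrite powR_gt0.
pose e := eta / 2 / 2 `^ p.
have e0 : 0 < e by rewrite !divr_gt0.
have [n [f [K [mf fX]]]] := XJ _ e0.
have mJ0 : 0 <= fine (mu J) by rewrite fine_ge0.
pose t := Num.min 1 (e / (fine (mu J) + 1)).
have t0 : 0 < t by rewrite lt_min ltr01/= divr_gt0// ltr_wpDl.
have [l ml lf] := quantize n K mf t0.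
exists l => // h Xh.
have [c cK ch] := fX _ Xh.
have [w wc] := lf _ cK.
exists w.
have mg := measurable_lincomb n c mf.
set g := fun x => \sum_(i < n) c i * f i x in mg ch.
have mh := mX _ Xh.
apply: (@le_trans _ _ (\int[mu]_(x in J)
   ((2 `^ p)%:E * ((`|h x - g x| `^ p)%:E + (t `^ p)%:E)))%E).
  apply: ge0_le_integral => //.
  - apply: measurable_funTS; apply: measurable_norm_powR.
    exact: measurable_label_comp.
  - apply: measurable_funTS; apply: emeasurable_funM => //.
    apply: emeasurable_funD => //; apply: measurable_norm_powR.
    exact: measurable_funB.
  - move=> x _; rewrite -EFinD -EFinM lee_fin.
    rewrite -(subrKA (g x)).
    apply: (le_trans (powR_normD_le _ _)); rewrite ler_wpM2l ?powR_ge0// lerD2l.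
    by rewrite ge0_ler_powR ?nnegrE ?(ltW p0) ?(ltW t0) ?normr_ge0//; exact: wc.
have mhg : measurable_fun J (fun x => (`|h x - g x| `^ p)%:E).
  by apply: measurable_funTS; apply: measurable_norm_powR; exact: measurable_funB.
rewrite ge0_integralZl//; last 2 first.
- by apply: emeasurable_funD => //; exact: measurable_cst.
- by move=> x _; rewrite -EFinD lee_fin addr_ge0 ?powR_ge0.
rewrite ge0_integralD//; last by move=> x _; rewrite lee_fin powR_ge0.
rewrite integral_cst//.
apply: (@le_trans _ _ ((2 `^ p)%:E * (e%:E + e%:E))%E).
  rewrite lee_pmul2l//; apply: leeD => //.
  rewrite -(fineK (_ : mu J \is a fin_num)) ?ge0_fin_numE// -EFinM lee_fin.
  apply: (@le_trans _ _ (t * fine (mu J))).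
    rewrite ler_wpM2r//.
    by rewrite ge1r_powR// t0/= ge_min lexx.
  apply: (@le_trans _ _ (e / (fine (mu J) + 1) * fine (mu J))).
    by rewrite ler_wpM2r// ge_min lexx orbT.
  rewrite mulrAC ler_pdivrMr ?ltr_wpDl// ler_pM2l//.
  by rewrite lerDl.
rewrite -EFinD -EFinM lee_fin /e -mulrDl mulrCA divff ?gt_eqF// mulr1.
by rewrite -splitr.
Qed.

(** The piece of index [i] gets the error budget [eta / 2 ^ i.+1], and these budgets sum to [eta].
    Cells have finite measure because each lies inside one piece, which is what averaging over them
    requires. *)
Lemma global_label (X : set (T -> R)) (k : T -> nat) (eta : R) :
  (forall h, X h -> measurable_fun [set: T] h) ->
  measurable_fun [set: T] k -> (forall i, mu (k @^-1` [set i]) < +oo)%E ->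
  (forall i, finite_dim_approx X (k @^-1` [set i])) -> 0 < eta ->
  exists l : T -> nat, [/\ measurable_fun [set: T] l,
    (forall j, mu (l @^-1` [set j]) < +oo)%E &
    forall h, X h -> exists w : nat -> R,
      (\int[mu]_x (`|h x - w (l x)| `^ p)%:E <= eta%:E)%E].
Proof.
move=> mX mk koo Xk eta0.
have mki i := measurable_label_fiber i mk.
have eta2 i : 0 < eta / (2 ^ i.+1)%:R by rewrite divr_gt0// ltr0n expn_gt0.
have [L LX] : exists L : nat -> T -> nat, forall i,
    measurable_fun [set: T] (L i) /\ forall h, X h -> exists w : nat -> R,
    (\int[mu]_(x in k @^-1` [set i]) (`|h x - w (L i x)| `^ p)%:E <=
     (eta / (2 ^ i.+1)%:R)%:E)%E.
  have /choice[L LP] : forall i, exists l : T -> nat,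
      measurable_fun [set: T] l /\ forall h, X h -> exists w : nat -> R,
      (\int[mu]_(x in k @^-1` [set i]) (`|h x - w (l x)| `^ p)%:E <=
       (eta / (2 ^ i.+1)%:R)%:E)%E.
    move=> i; have [l ? ?] := local_label mX (mki i) (koo i) (Xk i) (eta2 i).
    by exists l.
  by exists L.
(* Local labels on different pieces may coincide, so the global label also records the piece. *)
pose l x := pickle (k x, L (k x) x).
have lE (i j : nat) : l @^-1` [set pickle (i, j)] =
    k @^-1` [set i] `&` L i @^-1` [set j].
  apply/seteqP; split => x /=; last by rewrite /l => -[-> ->].
  by rewrite /l => /(pcan_inj pickleK)[<- <-].
have l0 m : ~ (exists i j : nat, pickle (i, j) = m) -> l @^-1` [set m] = set0.
  move=> nm; apply/seteqP; split => // x /= xm; apply: nm.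
  by exists (k x), (L (k x) x).
have ml : measurable_fun [set: T] l.
  apply: measurable_fun_label => m.
  have [[i [j <-]]|/l0 ->] := pselect (exists i j : nat, pickle (i, j) = m); last first.
    exact: measurable0.
  rewrite lE; apply: measurableI => //.
  by apply: measurable_label_fiber; exact: (LX i).1.
exists l; split => // [m|h Xh].
  have [[i [j mE]]|/l0 ->] := pselect (exists i j : nat, pickle (i, j) = m); last first.
    by rewrite measure0.
  apply: le_lt_trans (koo i); apply: le_measure; rewrite ?inE//.
    exact: measurable_label_fiber.
  by rewrite -mE lE; exact: subIsetl.
have /choice[W WP] i := (LX i).2 h Xh.
exists (fun m => let ij := odflt (0, 0)%N (unpickle m) in W ij.1 ij.2).
rewrite (ge0_integral_fibers mu mk)//; last first.
  apply: measurable_norm_powR; apply: (measurable_label_comp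
    (fun m => let ij := odflt (0, 0)%N (unpickle m) in W ij.1 ij.2)) => //.
  exact: mX.
apply: le_trans (epsilon_trick0 xpredT (ltW eta0)).
apply: lee_nneseries => [i _ _|i _].
  by apply: integral_ge0 => x _; rewrite lee_fin powR_ge0.
apply: le_trans (WP i); rewrite le_eqVlt; apply/orP; left; apply/eqP.
apply: eq_integral => x; rewrite inE/= /l => <-.
by rewrite pickleK.
Qed.

End Approximation.

(** * Averaging over the cells, as a contraction from L_p to l_p *)

Section Averaging.
Context d (T : measurableType d) (R : realType).
Variables (mu : {measure set T -> \bar R}) (p : R).
Hypothesis p1 : 1 <= p.

Let p0 : 0 < p. Proof. exact: lt_le_trans p1. Qed.
Let ep1 : (1 <= p%:E)%E. Proof. by rewrite lee_fin. Qed.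

Lemma LfunP_measurable (h : T -> R) :
  h \in Lfun mu p%:E -> measurable_fun [set: T] h.
Proof. by move=> /sub_Lfun_mfun; rewrite inE. Qed.

Lemma LfunP_finite (h : T -> R) : h \in Lfun mu p%:E ->
  ('N[mu]_(p%:E)[EFin \o h] < +oo)%E.
Proof. by move=> /sub_Lfun_finLfun; rewrite inE. Qed.

Lemma Lfun_powR_integral_lty (h : T -> R) (D : set T) : measurable D ->
  h \in Lfun mu p%:E -> (\int[mu]_(x in D) (`|h x| `^ p)%:E < +oo)%E.
Proof.
move=> mD hp.
have mh := LfunP_measurable hp.
apply: (@le_lt_trans _ _ (\int[mu]_x (`|h x| `^ p)%:E)%E).
  apply: ge0_subset_integral => //; first exact: measurable_norm_powR.
have := LfunP_finite hp => /(poweR_lty p).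
by rewrite poweR_Lnorm ?gt_eqF.
Qed.

Lemma hoelder_finite_set (h : T -> R) (D : set T) : measurable D ->
  (mu D < +oo)%E -> measurable_fun [set: T] h ->
  (\int[mu]_(x in D) `|h x|%:E <=
   (\int[mu]_(x in D) (`|h x| `^ p)%:E) `^ p^-1 *
   (fine (mu D) `^ (1 - p^-1))%:E)%E.
Proof.
move=> mD Doo mh.
(* For [p = 1] the conjugate exponent is infinite and the second factor is a zeroth power, hence 1.
   Otherwise Hoelder is applied to [h \* \1_D] and [\1_D]. *)
have [pE|pn1] := eqVneq p 1.
  rewrite pE invr1 subrr powRr0 mule1 poweRe1; last first.
    by apply: integral_ge0 => x _; rewrite lee_fin powR_ge0.
  by under [leRHS]eq_integral do rewrite powRr1//.
have p_gt1 : 1 < p by rewrite lt_neqAle eq_sym pn1.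
have iD : measurable_fun [set: T] (\1_D : T -> R) by [].
have q0 : 0 < 1 - p^-1 by rewrite subr_gt0 invf_lt1.
have := @hoelder _ _ _ mu (h \* \1_D) \1_D p (1 - p^-1)^-1
  (measurable_funM mh iD) iD p0.
rewrite invr_gt0 q0 invrK subrKC => /(_ isT erefl).
rewrite Lnorm1 unlock invrK.
congr (_ <= _ * _)%E.
- rewrite [RHS]integral_mkcond; apply: eq_integral => x _.
  rewrite patchE /= indicE; case: ifPn => _ /=; first by rewrite !mulr1.
  by rewrite !mulr0 normr0.
- congr (_ `^ _)%E.
  rewrite [RHS]integral_mkcond; apply: eq_integral => x _.
  rewrite patchE /= indicE; case: ifPn => _ /=; first by rewrite !mulr1.
  by rewrite !mulr0 normr0 powR0// gt_eqF.
- rewrite (_ : (\int[mu]_x _)%E = mu D).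
    by rewrite -(fineK (_ : mu D \is a fin_num)) ?ge0_fin_numE.
  rewrite -[RHS]mul1e -integral_cst// [RHS]integral_mkcond.
  apply: eq_integral => x _.
  rewrite patchE /= indicE; case: ifPn => _ /=; first by rewrite normr1 powR1.
  by rewrite normr0 powR0// gt_eqF// invr_gt0.
Qed.

Lemma Lfun_integrable_finite_set (h : T -> R) (D : set T) : measurable D ->
  (mu D < +oo)%E -> h \in Lfun mu p%:E -> mu.-integrable D (EFin \o h).
Proof.
move=> mD Doo hp; apply/integrableP; split.
  by apply/measurable_EFinP; apply: measurable_funTS; exact: LfunP_measurable.
apply: (le_lt_trans (hoelder_finite_set mD Doo (LfunP_measurable hp))).
rewrite muleC lte_mul_pinfty ?lee_fin ?powR_ge0//.
by apply: poweR_lty; exact: Lfun_powR_integral_lty.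
Qed.

Variable l : T -> nat.
Hypotheses (ml : measurable_fun [set: T] l)
  (loo : forall j, (mu (l @^-1` [set j]) < +oo)%E).

Let A j := l @^-1` [set j].
Let m j := fine (mu (A j)).
Let mA j : measurable (A j) := measurable_label_fiber j ml.

(* Averages over the cells, scaled so that functions constant on each cell are
   mapped isometrically into l_p. *)
Definition cell_averages (h : T -> R) : nat -> R :=
  fun j => m j `^ (p^-1 - 1) * (\int[mu]_(x in A j) h x)%R.

Lemma cell_averagesD (f g : T -> R) :
  f \in Lfun mu p%:E -> g \in Lfun mu p%:E ->
  cell_averages (fun x => f x + g x) =
  (fun j => cell_averages f j + cell_averages g j).
Proof.
move=> fp gp; apply/funext => j.
rewrite /cell_averages -mulrDr RintegralD//.
- exact: Lfun_integrable_finite_set (mA j) (loo j) fp.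
- exact: Lfun_integrable_finite_set (mA j) (loo j) gp.
Qed.

Lemma cell_averagesZ (f : T -> R) (c : R) : f \in Lfun mu p%:E ->
  cell_averages (fun x => c * f x) = (fun j => c * cell_averages f j).
Proof.
move=> fp; apply/funext => j.
rewrite /cell_averages mulrCA RintegralZl//.
exact: Lfun_integrable_finite_set (mA j) (loo j) fp.
Qed.

Lemma cell_averages_le (h : T -> R) j : h \in Lfun mu p%:E ->
  ((`|cell_averages h j| `^ p)%:E <= \int[mu]_(x in A j) (`|h x| `^ p)%:E)%E.
Proof.
move=> hp.
have mh := LfunP_measurable hp.
have Ioo := Lfun_powR_integral_lty (mA j) hp.
have I0 : (0 <= \int[mu]_(x in A j) (`|h x| `^ p)%:E)%E.
  by apply: integral_ge0 => x _; rewrite lee_fin powR_ge0.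
have m0 : 0 <= m j by rewrite fine_ge0.
have hint := Lfun_integrable_finite_set (mA j) (loo j) hp.
have H := hoelder_finite_set (mA j) (loo j) mh.
have {}H : `|(\int[mu]_(x in A j) h x)%R| <=
    fine (\int[mu]_(x in A j) (`|h x| `^ p)%:E) `^ p^-1 * m j `^ (1 - p^-1).
  rewrite -lee_fin EFinM -poweR_EFin fineK ?ge0_fin_numE//.
  rewrite EFin_normr_Rintegral//; apply: le_trans H.
  by apply: le_abse_integral => //; case/integrableP: hint.
rewrite -[leRHS]fineK ?ge0_fin_numE// lee_fin.
set S := fine (\int[mu]_(x in A j) _)%E in H *.
have S0 : 0 <= S by rewrite fine_ge0.
rewrite -[leRHS]powRr1// -[in leRHS](@mulVf _ p) ?gt_eqF// powRrM.
rewrite ge0_ler_powR ?nnegrE ?powR_ge0 ?(ltW p0)//.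
rewrite /cell_averages normrM ger0_norm ?powR_ge0//.
apply: (le_trans (ler_wpM2l (powR_ge0 _ _) H)).
rewrite mulrCA ler_piMr ?powR_ge0//.
(* On a null cell the powers cannot be combined: 0 raised to a nonzero exponent, even a negative
   one, is 0, while its zeroth power is 1. *)
have [->|mj0] := eqVneq (m j) 0.
  have [->|pn1] := eqVneq p^-1 1; first by rewrite subrr powRr0 mulr1.
  by rewrite powR0 ?mul0r// subr_eq0.
by rewrite -powRD ?mj0 ?implybT// subrKA subrr powRr0.
Qed.

Lemma cell_averages_label (w : nat -> R) j :
  ((`|cell_averages (w \o l) j| `^ p)%:E =
   \int[mu]_(x in A j) (`|w (l x)| `^ p)%:E)%E.
Proof.
have -> : (\int[mu]_(x in A j) (`|w (l x)| `^ p)%:E)%E =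
          (\int[mu]_(x in A j) (`|w j| `^ p)%:E)%E.
  by apply: eq_integral => x; rewrite inE /A/= => ->.
rewrite integral_cst// -(fineK (_ : mu (A j) \is a fin_num)); last first.
  by rewrite ge0_fin_numE ?loo.
rewrite -EFinM /cell_averages; congr EFin.
rewrite (@eq_Rintegral _ _ _ _ _ (cst (w j))); last first.
  by move=> x; rewrite inE /A/= => ->.
rewrite Rintegral_cst// -/(m j) mulrCA normrM powRM//; congr (_ * _).
have m0 : 0 <= m j by rewrite fine_ge0.
rewrite ger0_norm ?mulr_ge0 ?powR_ge0//.
have [->|mj0] := eqVneq (m j) 0; first by rewrite mulr0 powR0 ?gt_eqF.
rewrite -{2}(powRr1 m0) -powRD ?mj0 ?implybT// subrK -powRrM mulVf ?gt_eqF//.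
by rewrite powRr1.
Qed.

Local Notation "'l_p [ a ]" := ('N[@counting nat R]_(p%:E)[EFin \o a])%E
  (at level 0).

Lemma Lnorm_fibers (h : T -> R) : measurable_fun [set: T] h ->
  ('N[mu]_(p%:E)[EFin \o h] =
   (\sum_(j <oo) \int[mu]_(x in A j) (`|h x| `^ p)%:E) `^ p^-1)%E.
Proof.
move=> mh; rewrite unlock; congr (_ `^ _)%E.
by rewrite -ge0_integral_fibers//; exact: measurable_norm_powR.
Qed.

Lemma cell_averages_contract (h : T -> R) : h \in Lfun mu p%:E ->
  ('l_p[cell_averages h] <= 'N[mu]_(p%:E)[EFin \o h])%E.
Proof.
move=> hp; rewrite Lnorm_counting// (Lnorm_fibers (LfunP_measurable hp)).
have H : (\sum_(k <oo) (`|cell_averages h k| `^ p)%:E <=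
    \sum_(j <oo) \int[mu]_(x in A j) (`|h x| `^ p)%:E)%E.
  by apply: lee_nneseries => [j _ _|j _]; [rewrite lee_fin powR_ge0|
    exact: cell_averages_le].
apply: gt0_ler_poweR => //; rewrite ?invr_ge0 ?(ltW p0)//.
  by rewrite in_itv/= leey andbT nneseries_ge0// => j _ _; rewrite lee_fin powR_ge0.
rewrite in_itv/= leey andbT nneseries_ge0// => j _ _.
by apply: integral_ge0 => x _; rewrite lee_fin powR_ge0.
Qed.

Lemma cell_averages_label_norm (w : nat -> R) :
  ('l_p[cell_averages (w \o l)] = 'N[mu]_(p%:E)[EFin \o (w \o l)])%E.
Proof.
rewrite Lnorm_counting// Lnorm_fibers.
  by congr (_ `^ _)%E; apply: eq_eseriesr => j _; exact: cell_averages_label.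
exact: (@measurableT_comp _ _ _ _ _ _ w).
Qed.

(** Write [h] as [w \o l] plus a remainder [u] of norm at most [delta]. One [delta] is lost in
    passing from [h] to [w \o l], where averaging is isometric, and another in returning to the
    averages of [h], since averaging contracts [u]. *)
Lemma cell_averages_almost_isometry (h : T -> R) (w : nat -> R) (delta : R) :
  h \in Lfun mu p%:E ->
  ('N[mu]_(p%:E)[EFin \o (fun x => h x - w (l x))%R] <= delta%:E ->
   'N[mu]_(p%:E)[EFin \o h] <= 'l_p[cell_averages h] + (delta + delta)%:E)%E.
Proof.
move=> hp hw.
have mh := LfunP_measurable hp.
pose u x := h x - w (l x).
have mu_ : measurable_fun [set: T] u by exact: measurable_label_comp.
have up : u \in Lfun mu p%:E.
  rewrite inE; apply/andP; split; rewrite inE//=.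
  by apply: (le_lt_trans hw); rewrite ltry.
(* Nothing is assumed on the growth of [w]; that [w \o l] is in L_p follows from its being
   [h - u]. *)
have wE : w \o l = (fun x => h x + (-1) * u x).
  by apply/funext => x; rewrite /u/= mulN1r opprB subrKC.
have wp : w \o l \in Lfun mu p%:E.
  rewrite wE -[X in X \in _]/(h + (fun x => -1 * u x)).
  have := Lfun_submod_closed mu ep1; case=> _ /(_ (-1) u h up hp).
  by rewrite addrC.
have Tw : (cell_averages (w \o l) \+ cell_averages u) = cell_averages h.
  transitivity (cell_averages (fun x => (w \o l) x + u x)).
    by rewrite cell_averagesD.
  by congr cell_averages; apply/funext => x; rewrite /u /= subrKC.
have Nh : ('N[mu]_(p%:E)[EFin \o h] <=
    'N[mu]_(p%:E)[EFin \o (w \o l)] + 'N[mu]_(p%:E)[EFin \o u])%E.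
  have := minkowski_EFin mu (LfunP_measurable wp) mu_ p1.
  congr (_ <= _)%E; congr Lnorm; apply/funext => x /=.
  by rewrite /u subrKC.
have NT := lerB_DLnorm (@counting nat R) (f := cell_averages (w \o l))
  (g := cell_averages u).
rewrite Tw in NT.
apply: (le_trans Nh); rewrite EFinD addeA leeD//.
rewrite -cell_averages_label_norm; apply: (le_trans (NT _ _ _ _)) => //.
rewrite leeD2l//; apply: le_trans hw; exact: cell_averages_contract.
Qed.

End Averaging.

(** * Norms and restrictions in L_p of the real line *)

Section LebesgueSpace.
Context (R : realType) (p : R).
Hypothesis p1 : 1 <= p.
Implicit Types (f g h u : R -> R) (X : set (R -> R)) (I : set R).

Local Notation mu := (@lebesgue_measure R).
Local Notation nrm := (Lpnorm p%:E).

Let p0 : 0 < p. Proof. exact: lt_le_trans p1. Qed.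
Let ep1 : (1 <= p%:E)%E. Proof. by rewrite lee_fin. Qed.

Lemma inL_Lfun f : inL p%:E f <-> f \in Lfun mu p%:E.
Proof.
split=> [[mf fp]|fp]; first by rewrite inE; apply/andP; split; rewrite inE.
by split; [exact: LfunP_measurable fp|exact: LfunP_finite fp].
Qed.

Lemma inL_lin f g (c : R) : inL p%:E f -> inL p%:E g ->
  inL p%:E (fun x => f x + c * g x).
Proof.
move=> /inL_Lfun fp /inL_Lfun gp; apply/inL_Lfun.
have := Lfun_submod_closed mu ep1; case=> _ /(_ c g f gp fp).
by rewrite addrC.
Qed.

Lemma inL_sub_lincomb (n : nat) h (c : nat -> R) (f : nat -> R -> R) :
  inL p%:E h -> (forall i, inL p%:E (f i)) ->
  inL p%:E (fun x => h x - \sum_(i < n) c i * f i x).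
Proof.
move=> hp fp; elim: n => [|n IH].
  by congr inL: hp; apply/funext => x; rewrite big_ord0 subr0.
have := inL_lin (- c n) IH (fp n); congr inL; apply/funext => x.
by rewrite big_ord_recr/= opprD addrA mulNr.
Qed.

Lemma LpnormE (q : \bar R) f : inL q f ->
  (Lpnorm q f)%:E = ('N[mu]_q[EFin \o f])%E.
Proof. by move=> [_ fq]; rewrite fineK// ge0_fin_numE// Lnorm_ge0. Qed.

Lemma Lpnorm_ge0 (q : \bar R) f : 0 <= Lpnorm q f.
Proof. by rewrite fine_ge0// Lnorm_ge0. Qed.

Lemma LpnormD f g : inL p%:E f -> inL p%:E g ->
  nrm (fun x => f x + g x) <= nrm f + nrm g.
Proof.
move=> fp gp.
have fgp : inL p%:E (fun x => f x + g x).
  rewrite (_ : (fun x => _) = (fun x => f x + 1 * g x)); first exact: inL_lin.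
  by apply/funext => x; rewrite mul1r.
rewrite -lee_fin EFinD !LpnormE//.
exact: (minkowski_EFin mu fp.1 gp.1 p1).
Qed.

Lemma LpnormZ f (c : R) : inL p%:E f -> nrm (fun x => c * f x) = `|c| * nrm f.
Proof.
move=> /inL_Lfun fp.
have := LnormZ (Lfun_Sub ep1 fp) c.
move/(congr1 fine); rewrite /Lpnorm /= => ->; rewrite fineM//.
by rewrite ge0_fin_numE ?Lnorm_ge0//; exact: LfunP_finite fp.
Qed.

Lemma inL_powR_integral f : inL p%:E f ->
  (\int[mu]_x (`|f x| `^ p)%:E = (nrm f `^ p)%:E)%E.
Proof.
move=> fp; by rewrite -poweR_EFin LpnormE// poweR_Lnorm ?gt_eqF.
Qed.

Lemma restr_powR_integral f I :
  (\int[mu]_x (`|restr I f x| `^ p)%:E = \int[mu]_(x in I) (`|f x| `^ p)%:E)%E.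
Proof.
rewrite [RHS]integral_mkcond; apply: eq_integral => x _.
rewrite patchE /restr; case: ifPn => // _.
by rewrite normr0 powR0// gt_eqF.
Qed.

Lemma inL_restr f I : measurable I -> inL p%:E f -> inL p%:E (restr I f).
Proof.
move=> mI fp; split.
  apply: (measurable_fun_ifT (g := f) (h := cst 0)) => //; last exact: fp.1.
  by apply: (measurable_fun_bool true); rewrite setTI preimage_mem_true.
rewrite /finite_norm unlock; apply: poweR_lty => /=.
rewrite restr_powR_integral; apply: Lfun_powR_integral_lty => //.
exact/inL_Lfun.
Qed.

Lemma Lpnorm_restr_le f I : measurable I -> inL p%:E f ->
  nrm (restr I f) <= nrm f.
Proof.
move=> mI fp; have rp := inL_restr mI fp.
rewrite -lee_fin !LpnormE// unlock /=.
apply: gt0_ler_poweR; rewrite ?invr_ge0 ?(ltW p0)//.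
- by rewrite in_itv/= leey andbT integral_ge0.
- by rewrite in_itv/= leey andbT integral_ge0.
rewrite restr_powR_integral; apply: ge0_subset_integral => //.
by apply: measurable_norm_powR; exact: fp.1.
Qed.

Lemma powR_integral_le f I (eta : R) : measurable I -> inL p%:E f -> 0 <= eta ->
  nrm (restr I f) <= eta `^ p^-1 ->
  (\int[mu]_(x in I) (`|f x| `^ p)%:E <= eta%:E)%E.
Proof.
move=> mI fp eta0 H.
rewrite -restr_powR_integral inL_powR_integral//; last exact: inL_restr.
rewrite lee_fin -[leRHS]powRr1// -[in leRHS](@mulVf _ p) ?gt_eqF// powRrM.
by rewrite ge0_ler_powR ?nnegrE ?powR_ge0 ?(ltW p0)// Lpnorm_ge0.
Qed.

(** * The embedding obtained from approximation on bounded intervals *)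

Definition unit_sphere X : set (R -> R) := [set h | X h /\ nrm h = 1].

Lemma almost_isometric_of_approx X : closed_subspace p X ->
  (forall i : nat, finite_dim_approx mu p (unit_sphere X)
     (bitv true (- i.+1%:R) false i.+1%:R)) ->
  almost_isometric_lp p X.
Proof.
move=> [XL X0 XD _] HX eps eps0.
(* The pieces are the annuli [i <= |x| < i.+1], each contained in the closed interval from [- i.+1]
   to [i.+1]. *)
pose k (x : R) := Num.truncn `|x|.
have kE i : k @^-1` [set i] = normr @^-1` `[(i%:R : R), i.+1%:R[%classic.
  apply/seteqP; split => x /=; rewrite in_itv/=.
    by move=> <-; exact: truncn_itv.
  by move=> ?; exact: truncn_def.
have mk : measurable_fun [set: R] k.
  apply: measurable_fun_label => i; rewrite kE.
  by rewrite -[X in measurable X]setTI; exact: normr_measurable.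
have kI i : k @^-1` [set i] `<=` bitv true (- i.+1%:R) false i.+1%:R.
  rewrite kE => x /=; rewrite in_itv/= => /andP[_ /ltW].
  by rewrite ler_norml /bitv/= in_itv.
have koo i : (mu (k @^-1` [set i]) < +oo)%E.
  apply: (@le_lt_trans _ _ (mu (bitv true (- i.+1%:R) false i.+1%:R))).
    apply: le_measure; rewrite ?inE//; first exact: measurable_label_fiber.
    exact: measurable_itv.
  by rewrite lebesgue_measure_itv/=; case: ifPn => _; rewrite ?ltry// -EFinD ltry.
(* Then [1 - 2 * delta] is exactly the required lower bound; the upper bound follows from
   contractivity. *)
pose delta := (1 - (1 + eps)^-1) / 2.
have e1 : 0 < 1 + eps by rewrite addr_gt0.
have d0 : 0 < delta.
  by rewrite divr_gt0// subr_gt0 invf_lt1// ltrDl.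
have XS : forall h, unit_sphere X h -> measurable_fun [set: R] h.
  by move=> h [/XL[]].
have kX i : finite_dim_approx mu p (unit_sphere X) (k @^-1` [set i]).
  move=> eta /HX -/(_ i)[n [f [K [mf H]]]].
  exists n, f, K; split => // h Xh; have [c cK hc] := H _ Xh.
  exists c => //; apply: le_trans hc; apply: ge0_subset_integral => //.
  - exact: measurable_label_fiber.
  - exact: measurable_itv.
  - apply: measurable_funTS; apply: measurable_norm_powR.
    apply: measurable_funB; [exact: XS|exact: measurable_lincomb].
have [l [ml loo lX]] :=
  @global_label _ _ _ mu p p1 _ k _ XS mk koo kX (powR_gt0 p d0).
have LX f : X f -> f \in Lfun mu p%:E by move=> /XL /inL_Lfun.
exists (cell_averages mu p l); split.
- move=> f g Xf Xg fg0; apply/funext => j.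
  (* The p-th power of [f - g] has integral 0, so every cell average of [f - g] vanishes; linearity
     then gives equal coordinates. *)
  have Xfg : X (fun x => f x + (-1) * g x) by exact: XD.
  have fgE : (fun x => f x + (-1) * g x) = (fun x => f x - g x).
    by apply/funext => x; rewrite mulN1r.
  have := @cell_averages_le _ _ _ mu p p1 l ml loo _ j (LX _ Xfg).
  have : (\int[mu]_(x in l @^-1` [set j]) (`|f x + -1 * g x| `^ p)%:E <= 0)%E.
    rewrite (_ : 0%E = \int[mu]_x (`|f x + -1 * g x| `^ p)%:E)%E; last first.
      rewrite inL_powR_integral; last exact: XL.
      by rewrite fgE fg0 powR0// gt_eqF.
    apply: ge0_subset_integral => //; first exact: measurable_label_fiber.
    by apply: measurable_norm_powR; have [] := XL _ Xfg.
  move=> /[swap]/le_trans/[apply]; rewrite lee_fin => T0.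
  have /eqP : `|cell_averages mu p l (fun x => f x + -1 * g x) j| `^ p = 0.
    by apply/eqP; rewrite eq_le T0 powR_ge0.
  rewrite powR_eq0 normr_eq0 => /andP[/eqP + _].
  rewrite (cell_averagesD p1 ml loo (g := fun x => -1 * g x)) ?LX//.
    by rewrite (cell_averagesZ p1 ml loo) ?LX// mulN1r => /subr0_eq.
  have := XD _ _ (-1) X0 Xg; congr X; apply/funext => x.
  by rewrite add0r.
- by move=> f g Xf Xg; apply: cell_averagesD => //; exact: LX.
- by move=> f c Xf; apply: cell_averagesZ => //; exact: LX.
- move=> f Xf; apply: le_lt_trans (cell_averages_contract p1 ml loo (LX _ Xf)) _.
  by have [] := XL _ Xf.
- move=> f Xf f1; apply/andP; split; last first.
    apply: (le_trans (cell_averages_contract p1 ml loo (LX _ Xf))).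
    by rewrite -LpnormE ?f1 ?lee_fin ?lerDl ?(ltW eps0)//; exact: XL.
  have [w fw] := lX f (conj Xf f1).
  have := @cell_averages_almost_isometry _ _ _ mu p p1 l ml loo f w delta (LX _ Xf).
  rewrite -(LpnormE (XL _ Xf)) f1.
  have Nw : ('N[mu]_(p%:E)[EFin \o (fun x => f x - w (l x))%R] <= delta%:E)%E.
    rewrite unlock /=.
    apply: (@le_trans _ _ ((delta `^ p)%:E `^ p^-1)%E).
      apply: gt0_ler_poweR; rewrite ?invr_ge0 ?(ltW p0)//.
        by rewrite in_itv/= leey andbT integral_ge0.
      by rewrite in_itv/= leey andbT lee_fin powR_ge0.
    by rewrite poweR_EFin -powRrM mulfV ?gt_eqF// powRr1// ltW.
  move=> /(_ Nw) H; rewrite -(@leeD2rE _ (delta + delta)%:E)//.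
  apply: le_trans H; rewrite -EFinD lee_fin /delta -splitr.
  by rewrite subrKC.
Qed.

(** * Case (i): frames *)

Lemma pairing_bound f g : inL p%:E f -> inL (hoelder_conjugate p%:E) g ->
  `|pairing f g| <= nrm f * Lpnorm (hoelder_conjugate p%:E) g.
Proof.
move=> fp gq.
have [mf _] := fp; have [mg _] := gq.
have mfg : measurable_fun [set: R] (fun x => f x * g x) by exact: measurable_funM.
have H : (\int[mu]_x `|(f x * g x)%:E| <=
    (nrm f * Lpnorm (hoelder_conjugate p%:E) g)%:E)%E.
  rewrite EFinM !LpnormE//.
  (* For [p > 1] this is Hoelder with real exponents. For [p = 1] the function [g] is bounded almost
     everywhere by its essential supremum. *)
  have [pE|pn1] := eqVneq p 1; last first.
    have p_gt1 : 1 < p by rewrite lt_neqAle eq_sym pn1.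
    have qE : hoelder_conjugate p%:E = (p / (p - 1))%:E.
      rewrite /hoelder_conjugate/= eqe gt_eqF// inver subr_eq0 (negbTE pn1).
      by rewrite -EFinM.
    rewrite qE -Lnorm1; apply: (hoelder mu mf mg) => //.
      by rewrite divr_gt0// subr_gt0.
    by rewrite invf_div -{1}(div1r p) -mulrDl subrKC mulfV// gt_eqF.
  have gb := ess_sup_ge mu (fun x => `|(g x)%:E|%E).
  move: gq; rewrite pE hoelder_conjugate1 => gq.
  have g0 := Lpnorm_ge0 +oo%E g.
  have Ng : \forall x \ae mu, `|g x| <= Lpnorm +oo g.
    apply: filterS gb => x; rewrite -lee_fin => /le_trans; apply.
    rewrite LpnormE// unlock ifT//.
    (* The norm of exponent [+oo] is the essential supremum only on a space of positive measure,
       which the unit interval witnesses. *)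
    apply: (@lt_le_trans _ _ (mu `[0, 1]%classic)).
      by rewrite lebesgue_measure_itv/= lte_fin ltr01 sube0 lte_fin.
    by apply: le_measure; rewrite ?inE.
  rewrite Lnorm1 -(LpnormE gq) muleC -ge0_integralZl//; last first.
    by apply/measurable_EFinP; exact: measurableT_comp.
  apply: ae_ge0_le_integral => //.
  - by apply/measurable_EFinP; exact: measurableT_comp.
  - by move=> x _; rewrite mule_ge0.
  - apply: emeasurable_funM => //.
    by apply/measurable_EFinP; exact: measurableT_comp.
  apply: (@filterS _ _ (ae_filter_ringOfSetsType mu) _ _ _ Ng) => x {}Ng _ /=.
  by rewrite -EFinM lee_fin normrM mulrC ler_wpM2r.
rewrite -lee_fin; apply: le_trans H.
rewrite /pairing; apply: le_trans (le_abse_integral _ _ _) => //; last first.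
  exact/measurable_EFinP.
(* [fine] sends infinite values to 0, so taking it cannot increase the absolute value. *)
by case: (integral _ _ _) => //= *; rewrite leey.
Qed.

(** The approximant is a partial sum of the frame expansion. On the unit sphere its coefficients are
    bounded by the norms of the [g i]; the sum of the first [n] norms dominates each of them. *)
Lemma approx_of_cond_star X (f g : nat -> R -> R) (b1 b2 : bool) (a b : R) :
  (forall h, X h -> inL p%:E h) -> is_frame p X f g -> cond_star p X f g ->
  finite_dim_approx mu p (unit_sphere X) (bitv b1 a b2 b).
Proof.
move=> XL [Xf gL _] star eta eta0.
have [n /(_ n (leqnn n)) H] := star _ (powR_gt0 p^-1 eta0) b1 a b2 b.
exists n, f, (\sum_(i < n) Lpnorm (hoelder_conjugate p%:E) (g i)); split.
  by move=> i; case: (XL _ (Xf i)).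
move=> h [Xh h1]; exists (fun i => pairing h (g i)).
  move=> i ni; apply: (le_trans (pairing_bound (XL _ Xh) (gL i))).
  rewrite h1 mul1r (bigD1 (Ordinal ni))//= lerDl sumr_ge0// => j _.
  exact: Lpnorm_ge0.
apply: powR_integral_le; rewrite ?(ltW eta0)//.
- exact: measurable_itv.
- by apply: (@inL_sub_lincomb n h (fun i => pairing h (g i)) f) => [|i]; exact: XL.
- by have := H _ Xh; rewrite h1 mulr1.
Qed.

(** * Case (ii): minimal systems *)

Lemma closed_subspace_lincomb X (f : nat -> R -> R) (n : nat) (a : nat -> R) :
  closed_subspace p X -> (forall i, X (f i)) ->
  X (fun x => \sum_(i < n) a i * f i x).
Proof.
move=> [_ X0 XD _] Xf; elim: n => [|n IH].
  by congr X: X0; apply/funext => x; rewrite big_ord0.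
have := XD _ _ (a n) IH (Xf n); congr X; apply/funext => x.
by rewrite big_ord_recr.
Qed.

Lemma biorthogonal_coef X (f : nat -> R -> R) (phi : (R -> R) -> R) (i n : nat)
    (a : nat -> R) :
  closed_subspace p X -> (forall j, X (f j)) -> dual_elt p X phi ->
  (forall j, phi (f j) = if i == j then 1 else 0) -> (i < n)%N ->
  phi (fun x => \sum_(j < n) a j * f j x) = a i.
Proof.
move=> cX Xf [phiD phiZ _] phif ni.
have [_ X0 _ _] := cX.
have XZ j : X (fun x => a j * f j x).
  have := closed_subspace_lincomb j.+1 (fun k => if k == j then a j else 0) cX Xf.
  congr X; apply/funext => x; rewrite big_ord_recr/= eqxx big1 ?add0r// => k _.
  by rewrite ltn_eqF ?mul0r.
have E m : phi (fun x => \sum_(j < m) a j * f j x) =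
    \sum_(j < m) a j * (if i == j then 1 else 0).
  elim: m => [|m IH].
    (* [phi] vanishes at the zero function by homogeneity with factor 0. *)
    rewrite big_ord0 -[RHS](mul0r (phi (fun=> 0))) -phiZ//; congr phi.
    by apply/funext => x; rewrite big_ord0 mul0r.
  rewrite big_ord_recr/= -IH -phif -phiZ// -phiD//; last first.
    exact: (closed_subspace_lincomb m a cX Xf).
  by congr phi; apply/funext => x; rewrite big_ord_recr.
rewrite E (bigD1 (Ordinal ni))//= eqxx mulr1 big1 ?addr0// => j ji.
by rewrite ifF ?mulr0//; apply: contraNF ji => /eqP ij; exact/eqP/val_inj.
Qed.

(** A general [h] need not be the sum of a series in the [f i]. It is replaced by a nearby finite
    combination [g2] of norm one: biorthogonality bounds the coefficients of [g2], and [cond_2star]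
    makes its terms from index [n] on small on the interval, so the first [n] terms of [g2]
    approximate [h] there. *)
Lemma approx_of_cond_2star X (f : nat -> R -> R) (b1 b2 : bool) (a b : R) :
  closed_subspace p X -> sn_bdd_fund_minimal p X f -> cond_2star p f ->
  finite_dim_approx mu p (unit_sphere X) (bitv b1 a b2 b).
Proof.
move=> cX [Xf [c [C [c0 cf]]] [fs [fsX fsf [M fsM]]] dense] star eta eta0.
have [XL _ XD _] := cX.
have fL i : inL p%:E (f i) by exact: XL.
pose e := eta `^ p^-1.
have e0 : 0 < e by exact: powR_gt0.
have [n H] := star _ (divr_gt0 e0 (ltr0n R 2)) b1 a b2 b.
(* For a norm-one [g2], [c * |fs i g2| <= nrm (f i) * |fs i g2| <= M]. *)
exists n, f, (M / c); split; first by move=> i; case: (fL i).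
move=> h [Xh h1].
(* The bound [1 / 2] keeps the norm [r] of [g] away from 0, so that [g] can be normalized; the bound
   [e / 4] gives [2 * delta + e / 2 <= e]. *)
pose delta := Num.min (1 / 2) (e / 4).
have d0 : 0 < delta by rewrite lt_min !divr_gt0.
have [N [a1 ha1]] := dense _ Xh _ d0.
pose g x := \sum_(i < N) a1 i * f i x.
have Xg : X g by exact: (closed_subspace_lincomb N a1 cX Xf).
have Lg := XL _ Xg; have Lh := XL _ Xh.
pose r := nrm g.
have Lhg : inL p%:E (fun x => h x - g x).
  exact: (@inL_sub_lincomb N h a1 f).
have Lgh : inL p%:E (fun x => -1 * (h x - g x)).
  have L0 : inL p%:E (fun=> 0) by case: cX => _ /XL.
  have := inL_lin (-1) L0 Lhg; congr inL; apply/funext => x.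
  by rewrite add0r.
have r1 : 1 <= delta + r.
  rewrite -h1; apply: le_trans (lerD ha1 (lexx _)).
  apply: le_trans (LpnormD Lhg Lg); rewrite le_eqVlt; apply/orP; left.
  by apply/eqP; congr Lpnorm; apply/funext => x; rewrite subrK.
have r2 : r <= 1 + delta.
  rewrite -h1; apply: le_trans (lerD (lexx _) ha1).
  rewrite -[X in _ <= _ + X]mul1r -(normr1 R) -normrN -LpnormZ//.
  apply: le_trans (LpnormD Lh Lgh); rewrite le_eqVlt; apply/orP; left.
  by apply/eqP; congr Lpnorm; apply/funext => x; rewrite mulN1r subKr.
have dhalf : delta <= 1 / 2 by rewrite ge_min lexx.
have de : delta <= e / 4 by rewrite ge_min lexx orbT.
have r0 : 0 < r by lra.
(* The combination is padded with zero coefficients so that its length exceeds [n] and [cond_2star]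
   applies. *)
pose m2 := maxn N n.+1.
pose a2 i := if (i < N)%N then a1 i / r else 0.
pose g2 x := \sum_(i < m2) a2 i * f i x.
have g2E : g2 = (fun x => r^-1 * g x).
  apply/funext => x; rewrite /g2 /g mulr_sumr.
  rewrite (big_ord_widen m2 (fun i => r^-1 * (a1 i * f i x))) ?leq_maxl//.
  rewrite [RHS]big_mkcond; apply: eq_bigr => i _; rewrite /a2.
  by case: ifPn => _; rewrite ?mul0r// mulrA (mulrC r^-1).
have Xg2 : X g2 by exact: (closed_subspace_lincomb m2 a2 cX Xf).
have g21 : nrm g2 = 1.
  by rewrite g2E LpnormZ// ger0_norm ?invr_ge0 ?(ltW r0)// mulVf ?gt_eqF.
have a2E i : (i < m2)%N -> a2 i = fs i g2.
  by move=> im; rewrite (biorthogonal_coef _ cX Xf (fsX i) (fsf i) im).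
exists a2.
  move=> i ni; have im : (i < m2)%N.
    by rewrite (leq_trans ni)// (leq_trans (leqnSn n))// leq_maxr.
  rewrite ler_pdivlMr// mulrC a2E//; have := fsM i _ Xg2; rewrite g21 mulr1.
  apply: le_trans; rewrite ler_wpM2r//.
  by case/andP: (cf i).
have mI : measurable (bitv b1 a b2 b : set R) by exact: measurable_itv.
apply: powR_integral_le; rewrite ?(ltW eta0)//.
  exact: (@inL_sub_lincomb n h a2 f).
(* With [m = n.+1] the sum starts at [m.-1 = n], so it is exactly what remains of [g2] after its
   first [n] terms. *)
have {}H := H n.+1 m2 m2 (ltnSn n) (leq_maxr _ _) (leqnn _) a2 g21.
rewrite /= in H.
pose u x := h x - g2 x.
pose v x := \sum_(n <= i < m2) a2 i * f i x.
have Lu : inL p%:E u by apply: (@inL_sub_lincomb m2 h a2 f).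
have uvE x : h x - \sum_(i < n) a2 i * f i x = u x + v x.
  rewrite /u /v /g2 -(big_mkord xpredT (fun i => a2 i * f i x)).
  rewrite -(big_mkord xpredT (fun i => a2 i * f i x)).
  rewrite (@big_cat_nat _ _ _ n 0 m2)//=; first by rewrite opprD addrA subrK.
  by rewrite (leq_trans (leqnSn n))// leq_maxr.
have Lv : inL p%:E v.
  have := inL_lin (-1) (@inL_sub_lincomb n h a2 f Lh fL) Lu.
  by congr inL; apply/funext => x; rewrite uvE mulN1r addrAC subrr add0r.
have ruv : restr (bitv b1 a b2 b) (fun x => h x - \sum_(i < n) a2 i * f i x) =
    (fun x => restr (bitv b1 a b2 b) u x + restr (bitv b1 a b2 b) v x).
  by apply/funext => x; rewrite /restr; case: ifP; rewrite ?addr0// uvE.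
rewrite ruv; apply: (le_trans (LpnormD _ _)); try exact: inL_restr.
(* Normalizing moves [g] by [|1 - r^-1| * r = |r - 1|], which is at most [delta] because [h] has
   norm one and [g] is within [delta] of it. *)
have nu : nrm u <= 2 * delta.
  have -> : u = (fun x => (h x - g x) + (1 - r^-1) * g x).
    by apply/funext => x; rewrite /u g2E; ring.
  have L1 : inL p%:E (fun x => (1 - r^-1) * g x).
    have L0 : inL p%:E (fun=> 0) by case: cX => _ /XL.
    have := inL_lin (1 - r^-1) L0 Lg; congr inL; apply/funext => x.
    by rewrite add0r.
  apply: (le_trans (LpnormD Lhg L1)); rewrite LpnormZ//.
  rewrite mulr_natl mulr2n lerD// -/r -[X in _ * X]ger0_norm ?(ltW r0)//.
  rewrite -normrM mulrBl mul1r mulVf ?gt_eqF// ler_norml; lra.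
apply: (@le_trans _ _ (2 * delta + e / 2)).
  by apply: lerD => //; apply: le_trans nu; exact: Lpnorm_restr_le.
rewrite -/e; lra.
Qed.

End LebesgueSpace.

Theorem theorem2p4 (R : realType) (p : R) (X : set (R -> R)) :
  1 <= p -> closed_subspace p X ->
  (exists f g : nat -> R -> R, is_frame p X f g /\ cond_star p X f g) \/
  (exists f : nat -> R -> R, sn_bdd_fund_minimal p X f /\ cond_2star p f) ->
  almost_isometric_lp p X.
Proof.
move=> p1 cX H; apply: almost_isometric_of_approx => // i.
case: H => [[f [g [fr star]]]|[f [sn star]]].
  by apply: (approx_of_cond_star p1 _ _ _ _ _ fr star); case: cX.
exact: (approx_of_cond_2star p1 _ _ _ _ cX sn star).
Qed.
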